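(* Let $(a_n)$ be a sequence of nonnegative numbers which is regular, has a positive level of distribution, and is locally uniform. For a parameter $x$, let $u$ be a random integer with $\mathbb{P}(u=m) = \frac{a_m}{N(x)}\mathbf{1}[1\le m\le x]$. Then there is a constant $K>0$ depending only on the sequence $(a_n)$ such that for every $\epsilon>0$, $$\limsup_{x\to\infty}\mathbb{P}\big(P^+(u)\ge u^{1-\epsilon}\big) \le K\epsilon.$$
   Context: $P^+(u)$ denotes the largest prime factor of the positive integer $u$. For a sequence $(a_n)_{n\ge1}$ of nonnegative numbers, define $N(x) = \sum_{n\leq x} a_n$ and $N_d(x) = \sum_{n\leq x,\ d\mid n} a_n$. $\mathbf{1}[\mathfrak{A}]$ is $1$ if $\mathfrak{A}$ holds and $0$ otherwise, and $\Omega(d)$ is the number of prime factors of $d$ counted with multiplicity. The sequence is called: (A) regular if for every fixed $c<1$, $N(x^c) = o(N(x))$ as $x\to\infty$; (B) of level of distribution $\vartheta$ if there is a multiplicative function $g$ with $g(d)\in[0,1]$ for all $d\ge1$, $\sum_{p\le x} g(p)\log p = \log x + O(1)$ (sum over primes), and $g(d) = O(C^{\Omega(d)}/d)$ for some constant $C\ge1$, such that for every $0<c<\vartheta$ and every $A>0$, $\sum_{d\le x^c} |N_d(x) - g(d)N(x)| \ll_{c,A} N(x)/(\log x)^A$; it has positive level of distribution if this holds for some $\vartheta>0$; (C) locally uniform if there are constants $\delta>0$, $B\ge0$, $C\ge1$ such that $N_d(x) \ll (\log x)^B C^{\Omega(d)} N(x)/d$ for all $d \le x^\delta$. *)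

(* Defs.v *)
From mathcomp Require Import all_boot all_order all_algebra.
From mathcomp Require Import all_classical all_reals all_analysis.

Set Implicit Arguments.
Unset Strict Implicit.
Unset Printing Implicit Defensive.

Import Order.TTheory GRing.Theory Num.Theory.
Import numFieldNormedType.Exports.

Local Open Scope classical_set_scope.
Local Open Scope ring_scope.

(* The Landau notations f =o_F g and f =O_F g look for a canonical structure   *)
(* of filter on F, which the library does not declare for +oo.                 *)
Canonical pinfty_filter_on (R : numFieldType) :=
  FilterType (pinfty_nbhs R) _.

(* A sequence (a_n)_(n >= 1) is a function on nat whose value at 0 is never    *)
(* used. Since truncn x is 0 for x < 1, the range 1 <= n < (truncn x).+1       *)
(* consists of the integers 1 <= n <= x, for every real x.                     *)
Definition summatory (R : realType) (a : nat -> R) (x : R) : R :=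
  \sum_(1 <= n < (Num.truncn x).+1) a n.

Definition summatory_dvd (R : realType) (a : nat -> R) (d : nat) (x : R) : R :=
  \sum_(1 <= n < (Num.truncn x).+1 | (d %| n)%N) a n.

(* Prime factors counted with multiplicity. *)
Definition prime_Omega (d : nat) : nat := (\sum_(p <- primes d) logn p d)%N.

Definition multiplicative (R : realType) (g : nat -> R) : Prop :=
  g 1%N = 1 /\
  forall m n : nat, (0 < m)%N -> (0 < n)%N -> coprime m n ->
    g (m * n)%N = g m * g n.

Definition regular (R : realType) (a : nat -> R) : Prop :=
  forall c : R, c < 1 ->
    (fun x : R => summatory a (x `^ c) : R^o)
      =o_ +oo (fun x : R => summatory a x : R^o).

Definition level_of_distribution (R : realType) (a : nat -> R) (theta : R) :
    Prop :=
  exists g : nat -> R,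
    [/\ multiplicative g,
        forall d : nat, (0 < d)%N -> 0 <= g d <= 1,
        (fun x : R => \sum_(1 <= p < (Num.truncn x).+1 | prime p)
                        g p * ln p%:R - ln x : R^o)
          =O_ +oo (fun=> 1 : R^o),
        exists C M : R, 1 <= C /\
          forall d : nat, (0 < d)%N -> g d <= M * (C ^+ prime_Omega d / d%:R)
      & forall c A : R, 0 < c -> c < theta -> 0 < A ->
          (fun x : R => \sum_(1 <= d < (Num.truncn (x `^ c)).+1)
                          `|summatory_dvd a d x - g d * summatory a x| : R^o)
            =O_ +oo (fun x : R => summatory a x / ln x `^ A : R^o)].

Definition positive_level_of_distribution (R : realType) (a : nat -> R) :
    Prop :=
  exists2 theta : R, 0 < theta & level_of_distribution a theta.

(* The implied constant M is uniform in both d and x. *)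
Definition locally_uniform (R : realType) (a : nat -> R) : Prop :=
  exists delta B C M : R, [/\ 0 < delta, 0 <= B, 1 <= C &
    \forall x \near +oo, forall d : nat, (0 < d)%N -> d%:R <= x `^ delta ->
      summatory_dvd a d x <=
        M * (ln x `^ B * C ^+ prime_Omega d * summatory a x / d%:R)].

(* Main.v *)
(* If P^+(n) >= n^(1-eps) and n > x^(1/2), then n / P^+(n) <= x^eps, so n has no
   prime factor in (x^eps, x^kappa] for a small constant kappa: all its primes
   but one are at most x^eps and the remaining one exceeds x^kappa. By regularity
   it thus suffices to bound the mass of the n without prime factors in that range
   by O(eps) N(x), uniformly in eps up to an o(N(x)) depending on eps.
   This is done with the Brun-Hooley sieve. Put X = x^(kappa/2^J) with 2^J of order
   kappa/eps and split the range into J dyadic blocks (X^(2^j), X^(2^(j+1))].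
   Truncating the inclusion-exclusion over the primes of block j at 2(J-j)
   factors gives a nonnegative majorant of level x^(8 kappa); its main term is a
   product over the blocks of factors at most exp(-L_j + 10/2^(J-j)), where
   L_j is the sum of g(p) over the block. The L_j add up to
   log(2^J) + O(1) by the Mertens-type hypothesis on g, whence O(2^(-J)) = O(eps). *)

Require Import Defs.
From mathcomp Require Import all_boot all_order all_algebra.
From mathcomp Require Import all_classical all_reals all_analysis.
From mathcomp Require Import zify ring lra.

Import Order.TTheory GRing.Theory Num.Theory.
Import numFieldNormedType.Exports.

Local Open Scope classical_set_scope.
Local Open Scope ring_scope.

(** * Truncated inclusion-exclusion *)

(* The bound [size t < m] is strict, so that [m = 0] yields the empty family and
   the recursion needs no special case. *)
Fixpoint small_subs (s : seq nat) (m : nat) : seq (seq nat) :=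
  match s, m with
  | _, 0%N => [::]
  | [::], _.+1 => [:: [::]]
  | p :: s', k.+1 => small_subs s' k.+1 ++ [seq p :: t | t <- small_subs s' k]
  end.

Lemma small_subs_subseq s m t :
  t \in small_subs s m -> subseq t s && (size t < m)%N.
Proof.
elim: s m t => [|p s IH] [|m] t //=.
  by rewrite inE => /eqP ->.
rewrite mem_cat => /orP[/IH/andP[ts ->]|/mapP[r /IH/andP[rs rm] ->]].
  by rewrite andbT; exact: subseq_trans ts (subseq_cons s p).
by rewrite /= eqxx rs.
Qed.

Lemma small_subs_uniq s m : uniq s -> uniq (small_subs s m).
Proof.
elim: s m => [|p s IH] [|m] //= /andP[ps us].
rewrite cat_uniq IH // map_inj_uniq => [|x y [] //].
rewrite IH // andbT; apply/hasPn => t /mapP[r _ ->].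
apply/negP => /small_subs_subseq/andP[/mem_subseq sub _].
by move: ps; rewrite sub ?mem_head.
Qed.

(** With [w = - h] this is the inclusion-exclusion expansion of the product of the [1 - h p], cut
    off at fewer than [m] factors. *)
Definition small_sum {R : realType} (w : nat -> R) (s : seq nat) (m : nat) : R :=
  \sum_(t <- small_subs s m) \prod_(p <- t) w p.

Lemma small_sum_cons {R : realType} (w : nat -> R) p s m :
  small_sum w (p :: s) m.+1 = small_sum w s m.+1 + w p * small_sum w s m.
Proof.
rewrite /small_sum /= big_cat big_map /= mulr_sumr.
by congr (_ + _); apply: eq_bigr => t _; rewrite big_cons.
Qed.

(* Both inequalities propagate through the recursion [small_sum_cons], in which
   the signed difference for [m.+1] picks up [h p] times the one for [m]. *)
Lemma bonferroni {R : realType} (h : nat -> R) (s : seq nat) (m : nat) :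
  (forall p, p \in s -> 0 <= h p <= 1) ->
  0 <= (-1) ^+ m * (\prod_(p <- s) (1 - h p) - small_sum (fun p => - h p) s m)
    <= (\sum_(p <- s) h p) ^+ m / m`!%:R.
Proof.
elim: s m => [|p s IH] [|m] hs.
- by rewrite /small_sum /= !big_nil !expr0 fact0 divr1 subr0 mulr1 ler01 lexx.
- by rewrite /small_sum /= big_seq1 !big_nil subrr mulr0 lexx expr0n mul0r lexx.
- rewrite /small_sum /= big_nil subr0 !expr0 fact0 divr1 mul1r.
  apply/andP; split.
    rewrite big_seq prodr_ge0 // => q /hs /andP[_]; lra.
  rewrite big_seq; apply: prodr_ile1 => q /hs /andP[] *; lra.
- have hp : 0 <= h p <= 1 by apply: hs; rewrite mem_head.
  have hs' q : q \in s -> 0 <= h q <= 1.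
    by move=> qs; apply: hs; rewrite inE qs orbT.
  have /andP[A1 A2] := IH m.+1 hs'; have /andP[B1 B2] := IH m hs'.
  rewrite small_sum_cons !big_cons.
  set V := \prod_(_ <- s) _ in A1 A2 B1 B2 *.
  set S := small_sum _ s m.+1 in A1 A2 *; set S' := small_sum _ s m in B1 B2 *.
  set L := \sum_(_ <- s) _ in A2 B2 *.
  have L0 : 0 <= L by rewrite /L big_seq sumr_ge0 // => q /hs' /andP[].
  have -> : (-1) ^+ m.+1 * ((1 - h p) * V - (S + - h p * S')) =
     (-1) ^+ m.+1 * (V - S) + h p * ((-1) ^+ m * (V - S')).
    by rewrite exprS; ring.
  move: A1 A2 B1 B2; set X := (-1) ^+ m.+1 * _; set Y := (-1) ^+ m * _.
  move=> A1 A2 B1 B2; case/andP: hp => h0 _.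
  apply/andP; split; first by rewrite addr_ge0 // mulr_ge0.
  apply: le_trans (lerD A2 (ler_wpM2l h0 B2)) _.
  have f0 : 0 < m`!%:R :> R by rewrite ltr0n fact_gt0.
  have -> : L ^+ m.+1 / m.+1`!%:R + h p * (L ^+ m / m`!%:R) =
      (L ^+ m.+1 + h p * L ^+ m *+ m.+1) / m.+1`!%:R.
    rewrite factS natrM -mulr_natr; field.
    by rewrite nat1r !pnatr_eq0 -lt0n fact_gt0.
  rewrite ler_wpM2r ?invr_ge0 ?ler0n //.
  rewrite [h p + L]addrC exprDn big_ord_recl big_ord_recl /= bin0 bin1.
  rewrite subn0 expr0 mulr1 mulr1n subn1 expr1 [h p * _]mulrC addrA lerDl.
  by apply: sumr_ge0 => i _; rewrite mulrn_wge0 // mulr_ge0 // exprn_ge0.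
Qed.

(** These lists index the terms obtained by multiplying out one truncated sum per block. For blocks
    of primes, a list stands for the squarefree modulus that is its product. *)
Fixpoint block_subs (P : nat -> seq nat) (m : nat -> nat) (J : nat) :
    seq (seq nat) :=
  if J is k.+1 then
    [seq s ++ t | s <- block_subs P m k, t <- small_subs (P k) (m k)]
  else [:: [::]].

Lemma block_sum {R : realType} (w : nat -> R) P m J :
  \sum_(t <- block_subs P m J) \prod_(p <- t) w p =
  \prod_(j < J) small_sum w (P j) (m j).
Proof.
elim: J => [|J IH]; first by rewrite big_seq1 big_nil big_ord0.
rewrite big_ord_recr /= -IH big_allpairs_dep mulr_suml.
apply: eq_bigr => s _; rewrite mulr_sumr; apply: eq_bigr => t _.
by rewrite big_cat.
Qed.

(** * Prime ranges and products of distinct primes *)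

Definition prime_range (a b : nat) : seq nat :=
  [seq p <- index_iota a.+1 b.+1 | prime p].

Lemma mem_prime_range a b p :
  (p \in prime_range a b) = [&& prime p, (a < p)%N & (p <= b)%N].
Proof. by rewrite mem_filter mem_index_iota ltnS. Qed.

Lemma prime_range_uniq a b : uniq (prime_range a b).
Proof. by rewrite filter_uniq // iota_uniq. Qed.

Lemma prime_range_cat a b c : (a <= b)%N -> (b <= c)%N ->
  prime_range a c = prime_range a b ++ prime_range b c.
Proof.
move=> ab bc; rewrite /prime_range -filter_cat /index_iota.
have -> : (c.+1 - a.+1 = (b.+1 - a.+1) + (c.+1 - b.+1))%N by lia.
by rewrite iotaD; congr [seq p <- _ ++ iota _ _ | _]; lia.
Qed.

Lemma subseq_prime_rangeP t b : subseq t (prime_range 0 b) ->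
  [/\ sorted ltn t, uniq t & forall p, p \in t -> prime p && (p <= b)%N].
Proof.
move=> st; split.
- apply: (subseq_sorted ltn_trans st).
  by apply: sorted_filter; [exact: ltn_trans | exact: iota_ltn_sorted].
- exact: subseq_uniq st (prime_range_uniq _ _).
- by move=> p /(mem_subseq st); rewrite mem_prime_range => /and3P[-> _ ->].
Qed.

Lemma prod_primes_gt0 t : (forall p, p \in t -> prime p) ->
  (0 < \prod_(p <- t) p)%N.
Proof. by move=> tp; rewrite big_seq prodn_cond_gt0 // => p /tp /prime_gt0. Qed.

Lemma mem_primes_prod t : (forall p, p \in t -> prime p) ->
  primes (\prod_(p <- t) p) =i t.
Proof.
elim: t => [|q t IH] tp p; first by rewrite big_nil.
have tp' r : r \in t -> prime r by move=> rt; apply: tp; rewrite inE rt orbT.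
have qp : prime q by apply: tp; rewrite mem_head.
rewrite big_cons primesM ?(prime_gt0 qp) ?(prod_primes_gt0 t tp') //.
by rewrite primes_prime // (IH tp') !inE.
Qed.

(** By unique factorization, [primes] recovers the sorted list from its product. Hence sieve
    remainders indexed by lists run over distinct moduli. *)
Lemma prod_primes_inj b :
  {in [pred t | subseq t (prime_range 0 b)] &,
    injective (fun t : seq nat => (\prod_(p <- t) p)%N)}.
Proof.
have primesK t : subseq t (prime_range 0 b) -> primes (\prod_(p <- t) p) = t.
  move=> /subseq_prime_rangeP[ts _ tp].
  apply: (irr_sorted_eq ltn_trans ltnn (sorted_primes _) ts).
  by apply: mem_primes_prod => p /tp /andP[].
by move=> s t /primesK {2}<- /primesK {2}<- ->.
Qed.

Lemma coprime_prime_prod p t : prime p -> p \notin t ->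
  (forall q, q \in t -> prime q) -> coprime p (\prod_(q <- t) q).
Proof.
move=> pp pt tp; rewrite prime_coprime //; apply: contra pt => pd.
by rewrite -(mem_primes_prod t tp) mem_primes pp pd prod_primes_gt0.
Qed.

Lemma multiplicative_prod {R : realType} (g : nat -> R) t :
  Defs.multiplicative g -> uniq t -> (forall p, p \in t -> prime p) ->
  g (\prod_(p <- t) p)%N = \prod_(p <- t) g p.
Proof.
move=> [g1 gM]; elim: t => [|q t IH] /=; first by rewrite !big_nil.
move=> /andP[qt ut] tp.
have tp' r : r \in t -> prime r by move=> rt; apply: tp; rewrite inE rt orbT.
have qp : prime q by apply: tp; rewrite mem_head.
rewrite !big_cons gM ?(prime_gt0 qp) ?(prod_primes_gt0 t tp') ?IH //.
exact: coprime_prime_prod.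
Qed.

Lemma prod_primes_dvd n t : uniq t -> (forall p, p \in t -> prime p) ->
  (\prod_(p <- t) p %| n)%N = all (dvdn^~ n) t.
Proof.
elim: t => [|q t IH] /=; first by rewrite big_nil dvd1n.
move=> /andP[qt ut] tp.
have tp' r : r \in t -> prime r by move=> rt; apply: tp; rewrite inE rt orbT.
have qp : prime q by apply: tp; rewrite mem_head.
by rewrite big_cons Gauss_dvd ?IH //; exact: coprime_prime_prod.
Qed.

Lemma prod_le_expn_size (t : seq nat) b : (forall p, p \in t -> (p <= b)%N) ->
  (\prod_(p <- t) p <= b ^ size t)%N.
Proof.
elim: t => [|p t IH] tb; first by rewrite big_nil.
rewrite big_cons expnS leq_mul ?tb ?mem_head // IH // => q qt.
by rewrite tb // inE qt orbT.
Qed.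

(** * The sieve over consecutive blocks of primes *)

Definition range_block (y : nat -> nat) (j : nat) : seq nat :=
  prime_range (y j) (y j.+1).

Lemma block_subs_subseq y m J t : (forall j, (y j <= y j.+1)%N) ->
  t \in block_subs (range_block y) m J -> subseq t (prime_range 0 (y J)).
Proof.
move=> y_mono; elim: J t => [|J IH] t; first by rewrite inE => /eqP ->; rewrite sub0seq.
move=> /allpairsP[[r s] /= [/IH rs /small_subs_subseq /andP[ss _] ->]].
by rewrite (prime_range_cat 0 (y J)) // cat_subseq.
Qed.

Lemma block_subs_uniq y m J : (forall j, (y j <= y j.+1)%N) ->
  uniq (block_subs (range_block y) m J).
Proof.
move=> y_mono; elim: J => [//|J IH] /=; apply: allpairs_uniq => //.
  by rewrite small_subs_uniq // prime_range_uniq.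
(* Entries of [r] are at most [y J] and entries of [s] exceed it, so filtering at [y J] undoes the
   concatenation. *)
have lowK r s : r \in block_subs (range_block y) m J -> s \in small_subs (range_block y J) (m J) ->
    [seq p <- r ++ s | (p <= y J)%N] = r.
  move=> /(block_subs_subseq _ _ _ _ y_mono) /subseq_prime_rangeP[_ _ rp].
  move=> /small_subs_subseq /andP[/mem_subseq sP _].
  rewrite filter_cat (all_filterP _); last by apply/allP => p /rp /andP[].
  rewrite (_ : [seq p <- s | _] = [::]) ?cats0 //; apply/eqP.
  rewrite -[_ == _]negbK -has_filter; apply/hasPn => p /sP.
  by rewrite mem_prime_range -ltnNge => /and3P[].
move=> [r s] [r' s'] /allpairsP[[? ?] /= [ri si [-> ->]]].
move=> /allpairsP[[? ?] /= [ri' si' [-> ->]]] E.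
have Er := lowK _ _ ri si; rewrite E lowK // in Er.
by move: E; rewrite Er => /eqP; rewrite eqseq_cat // eqxx => /eqP ->.
Qed.

(** This controls the level of the sieve: block [j] supplies at most [(m j).-1] primes, none above
    [y j.+1]. *)
Lemma block_subs_prod_le y m J t : (forall j, (0 < y j)%N) ->
  t \in block_subs (range_block y) m J ->
  (\prod_(p <- t) p <= \prod_(j < J) y j.+1 ^ (m j).-1)%N.
Proof.
move=> y_gt0; elim: J t => [|J IH] t; first by rewrite inE => /eqP ->; rewrite big_nil big_ord0.
move=> /allpairsP[[r s] /= [/IH rle /small_subs_subseq /andP[/mem_subseq sP sm] ->]].
rewrite big_cat big_ord_recr /= leq_mul //.
apply: (@leq_trans (y J.+1 ^ size s)).
  apply: prod_le_expn_size => p /sP.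
  by rewrite mem_prime_range => /and3P[].
by rewrite leq_pexp2l //; case: (m J) sm.
Qed.


Lemma uniq_sub_ler_sum {R : realType} (r s : seq nat) (F : nat -> R) :
  uniq r -> uniq s -> {subset r <= s} -> {in s, forall i, 0 <= F i} ->
  \sum_(i <- r) F i <= \sum_(i <- s) F i.
Proof.
move=> ur us rs F0.
have /(perm_big _) -> /= : perm_eq r [seq i <- s | i \in r].
  apply: uniq_perm => //; first exact: filter_uniq.
  by move=> i; rewrite mem_filter andb_idr // => /rs.
rewrite big_filter big_mkcond /= big_seq [leRHS]big_seq.
by apply: ler_sum => i si; case: ifP => // _; exact: F0.
Qed.

(** By [bonferroni], an odd truncation overestimates the indicator of its block. The exact block
    indicators are nonnegative, so these inequalities can be multiplied together. *)
Lemma indicator_sieve_ge {R : realType} (m y : nat -> nat) J (n : nat) :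
  (forall j, (y j <= y j.+1)%N) -> (forall j, odd (m j)) ->
  (all (fun p => ~~ (p %| n)%N) (prime_range (y 0%N) (y J)))%:R <=
  \prod_(j < J) small_sum (fun p => - (p %| n)%N%:R) (range_block y j) (m j) :> R.
Proof.
move=> y_mono m_odd.
have y0 j : (y 0%N <= y j)%N by elim: j => // j /leq_trans; apply.
rewrite (_ : _%:R = \prod_(p <- prime_range (y 0%N) (y J)) (1 - (p %| n)%N%:R)); last first.
  elim: (prime_range _ _) => [|p s IH] /=; first by rewrite big_nil.
  rewrite big_cons -IH; case: (p %| n)%N => /=.
    by rewrite subrr mul0r.
  by rewrite subr0 mul1r.
have -> : \prod_(p <- prime_range (y 0%N) (y J)) (1 - (p %| n)%N%:R) =
    \prod_(j < J) \prod_(p <- range_block y j) (1 - (p %| n)%N%:R) :> R.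
  elim: J => [|J IH].
    by rewrite big_ord0 /prime_range /index_iota subnn big_nil.
  by rewrite (prime_range_cat _ (y J)) // big_cat big_ord_recr /= IH.
apply: ler_prod => j _; apply/andP; split.
  by apply: prodr_ge0 => p _; case: (p %| n)%N; rewrite /= ?subrr ?subr0 ?lexx ?ler01.
have := @bonferroni R (fun p => (p %| n)%N%:R) (range_block y j) (m j).
rewrite -signr_odd m_odd expr1 mulN1r oppr_ge0 subr_le0 => /(_ _)/andP[] // p _.
by case: (p %| n)%N; rewrite ?lexx ler01.
Qed.

(** The majorant of [indicator_sieve_ge] is summed against [a] and multiplied out. Each list gives,
    up to sign, [summatory_dvd] at its product [d]; replacing this by [g d * summatory a x] leaves
    the main term, and the errors sit at distinct moduli [d <= D]. *)
Lemma sieve_upper_bound {R : realType} (a g : nat -> R) (x : R)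
    (m y : nat -> nat) (J D : nat) :
  (forall n, (0 < n)%N -> 0 <= a n) -> Defs.multiplicative g ->
  (forall j, (y j <= y j.+1)%N) -> (forall j, (0 < y j)%N) ->
  (forall j, odd (m j)) -> (\prod_(j < J) y j.+1 ^ (m j).-1 <= D)%N ->
  \sum_(1 <= n < (Num.truncn x).+1 |
      all (fun p => ~~ (p %| n)%N) (prime_range (y 0%N) (y J))) a n <=
    summatory a x *
      \prod_(j < J) small_sum (fun p => - g p) (range_block y j) (m j) +
    \sum_(1 <= d < D.+1) `|summatory_dvd a d x - g d * summatory a x|.
Proof.
move=> a0 gM y_mono y_gt0 m_odd leD.
set B := block_subs (range_block y) m J.
have Bprime t : t \in B -> uniq t /\ forall p, p \in t -> prime p.
  move=> /(block_subs_subseq _ _ _ _ y_mono)/subseq_prime_rangeP[_ ut tp].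
  by split=> // p /tp /andP[].
pose sgn (t : seq nat) : R := \prod_(p <- t) -1.
have sgn1 t : `|sgn t| = 1.
  rewrite /sgn; elim: t => [|p t IH]; first by rewrite big_nil normr1.
  by rewrite big_cons normrM IH normrN1 mulr1.
pose r d := summatory_dvd a d x - g d * summatory a x.
apply: (@le_trans _ _ (\sum_(1 <= n < (Num.truncn x).+1) a n *
   \prod_(j < J) small_sum (fun p => - (p %| n)%N%:R) (range_block y j) (m j))).
  rewrite big_mkcond /= !big_nat; apply: ler_sum => n /andP[n0 _].
  have := @indicator_sieve_ge R m y J n y_mono m_odd.
  by case: ifP => _ /(ler_wpM2l (a0 _ n0)); rewrite ?mulr1 ?mulr0.
under eq_bigr => n _ do rewrite -block_sum mulr_sumr.
rewrite exchange_big /= -block_sum mulr_sumr.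
have -> : \sum_(t <- B) \sum_(1 <= n < (Num.truncn x).+1)
     a n * \prod_(p <- t) (- (p %| n)%N%:R) =
   \sum_(t <- B) sgn t * summatory_dvd a (\prod_(p <- t) p)%N x.
  rewrite !big_seq; apply: eq_bigr => t /Bprime[ut tp].
  rewrite /summatory_dvd [in RHS]big_mkcond mulr_sumr; apply: eq_bigr => n _.
  under eq_bigr => p _ do rewrite -mulN1r.
  rewrite big_split /= -/(sgn t) mulrCA; congr (_ * _).
  rewrite prod_primes_dvd //.
  have -> : \prod_(p <- t) (p %| n)%N%:R = (all (dvdn^~ n) t)%:R :> R.
    elim: (t) => [|p s IH]; first by rewrite big_nil.
    by rewrite big_cons IH /=; case: (p %| n)%N; rewrite ?mul1r ?mul0r.
  by case: ifP; rewrite ?mulr1 ?mulr0.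
have -> : \sum_(t <- B) summatory a x * \prod_(p <- t) - g p =
   \sum_(t <- B) sgn t * (g (\prod_(p <- t) p)%N * summatory a x).
  rewrite !big_seq; apply: eq_bigr => t /Bprime[ut tp].
  under eq_bigr => p _ do rewrite -mulN1r.
  rewrite big_split /= -/(sgn t) multiplicative_prod //; ring.
rewrite -lerBlDl -sumrB.
apply: (@le_trans _ _ (\sum_(t <- B) `|r (\prod_(p <- t) p)%N|)).
  apply: ler_sum => t _; rewrite -mulrBr (le_trans (ler_norm _)) //.
  by rewrite normrM sgn1 mul1r.
rewrite -(big_map (fun t : seq nat => \prod_(p <- t) p)%N predT (fun d => `|r d|)).
apply: uniq_sub_ler_sum => //.
- rewrite map_inj_in_uniq ?block_subs_uniq // => s t sB tB.
  by apply: (@prod_primes_inj (y J)); exact: (block_subs_subseq _ m _ _ y_mono).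
- exact: iota_uniq.
move=> _ /mapP[t tB ->]; rewrite mem_index_iota ltnS.
rewrite prod_primes_gt0; last by case/Bprime: tB.
by rewrite (leq_trans (block_subs_prod_le _ _ _ _ y_gt0 tB)).
Qed.

(** * The main term of the sieve *)

Lemma ler_expn2_fact m : (2 ^ m.-1 <= m`!)%N.
Proof.
elim: m => [//|[//|m] IH]; rewrite factS /= expnS leq_mul //.
Qed.

Lemma prod_1B_le_expR {R : realType} (h : nat -> R) (s : seq nat) :
  (forall p, p \in s -> 0 <= h p <= 1) ->
  0 <= \prod_(p <- s) (1 - h p) <= expR (- \sum_(p <- s) h p).
Proof.
elim: s => [|p s IH] hs; first by rewrite !big_nil oppr0 expR0 ler01 lexx.
have /andP[h0 h1] : 0 <= h p <= 1 by apply: hs; rewrite mem_head.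
have /IH/andP[V0 V1] : forall q, q \in s -> 0 <= h q <= 1.
  by move=> q qs; apply: hs; rewrite inE qs orbT.
rewrite !big_cons opprD expRD mulr_ge0 ?subr_ge0 //=.
by rewrite ler_pM ?subr_ge0 // expR_ge1Dx.
Qed.

Lemma expRN54_ge {R : realType} : 8^-1 <= expR (- (5 / 4)) :> R.
Proof.
have -> : - (5 / 4) = 2%:R * - (5 / 8) :> R by lra.
rewrite expRM_natl; apply: (@le_trans _ _ ((3 / 8) ^+ 2)); first by lra.
rewrite lerXn2r ?nnegrE ?expR_ge0 //.
by apply: le_trans (expR_ge1Dx _); lra.
Qed.

(** By [bonferroni] the truncation exceeds the full product, which is at most [expR (- L)], by at
    most [5 / 4 / 2 ^+ r]. As [L <= 5 / 4] forces [expR (- L) >= 1 / 8], this error is at most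
    [10 / 2 ^+ r] relative to [expR (- L)]. *)
Lemma small_sum_le_expR {R : realType} (h : nat -> R) (s : seq nat) (r : nat) :
  (forall p, p \in s -> 0 <= h p <= 1) -> \sum_(p <- s) h p <= 5 / 4 ->
  0 <= small_sum (fun p => - h p) s r.*2.+1 <=
    expR (- (\sum_(p <- s) h p) + 10 / 2 ^+ r).
Proof.
move=> hs L54; have /andP[V0 V1] := prod_1B_le_expR _ _ hs.
have := bonferroni _ _ r.*2.+1 hs.
set S := small_sum _ _ _; set V := \prod_(_ <- _) _ in V0 V1 *.
set L := \sum_(_ <- _) _ in L54 V1 *.
rewrite -signr_odd /= odd_double expr1 mulN1r opprB subr_ge0 => /andP[VS SV].
rewrite (le_trans V0 VS) /=.
have L0 : 0 <= L by rewrite /L big_seq sumr_ge0 // => q /hs /andP[].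
have eL : 8^-1 <= expR (- L).
  by apply: le_trans expRN54_ge _; rewrite ler_expR lerN2.
have tail : L ^+ r.*2.+1 / (r.*2.+1)`!%:R <= 5 / 4 / 2 ^+ r.
  apply: (@le_trans _ _ ((5 / 4) ^+ r.*2.+1 / 2 ^+ r.*2)).
    apply: ler_pM; rewrite ?exprn_ge0 ?invr_ge0 ?ler0n //.
      by rewrite lerXn2r ?nnegrE //; lra.
    rewrite lef_pV2 ?posrE ?exprn_gt0 ?ltr0n ?fact_gt0 //.
    by rewrite -natrX ler_nat (ler_expn2_fact r.*2.+1).
  (* What remains is [(5 / 8) ^ 2 = 25 / 64 <= 1 / 2], raised to the power [r]. *)
  rewrite exprS -mulrA ler_wpM2l //.
  rewrite -!exprVn -exprMn -mul2n exprM lerXn2r ?nnegrE ?exprn_ge0 //; lra.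
have r2 : 0 <= (2 ^+ r)^-1 :> R by rewrite invr_ge0 exprn_ge0.
rewrite expRD; apply: (@le_trans _ _ (expR (- L) * (1 + 10 / 2 ^+ r))).
  rewrite mulrDr mulr1.
  have : 8^-1 * (10 / 2 ^+ r) <= expR (- L) * (10 / 2 ^+ r).
    by rewrite ler_wpM2r // mulr_ge0.
  by set u := (2 ^+ r)^-1 in tail r2 *; lra.
by rewrite ler_wpM2l ?expR_ge0 // expR_ge1Dx.
Qed.

(* Allowing more factors in the lower blocks makes the truncation errors summable
   in [j] while the level stays bounded (see [sum_level_exponents_le]). *)
Lemma block_product_le {R : realType} (h : nat -> R) (y : nat -> nat) (J : nat) :
  (forall j, (y j <= y j.+1)%N) ->
  (forall p, prime p -> 0 <= h p <= 1) ->
  (forall j, (j < J)%N -> \sum_(p <- range_block y j) h p <= 5 / 4) ->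
  \prod_(j < J) small_sum (fun p => - h p) (range_block y j) (J - j).*2.+1
    <= expR (10 - \sum_(p <- prime_range (y 0%N) (y J)) h p).
Proof.
move=> y_mono h01 hL.
have y0 j : (y 0%N <= y j)%N by elim: j => // j /leq_trans; apply.
apply: (@le_trans _ _ (\prod_(j < J)
   expR (- (\sum_(p <- range_block y j) h p) + 10 / 2 ^+ (J - j)))).
  apply: ler_prod => j _; apply: small_sum_le_expR; last exact: hL.
  by move=> p; rewrite mem_prime_range => /and3P[/h01].
rewrite -expR_sum ler_expR big_split /= addrC sumrN lerD //.
  rewrite -mulr_sumr ger_pMr //.
  (* A geometric series: the relative errors of all blocks add up to at most 10 in the exponent. *)
  have -> : \sum_(j < J) (2 ^+ (J - j))^-1 = 1 - (2 ^+ J)^-1 :> R.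
    elim: J {y0 hL} => [|J IH]; first by rewrite big_ord0 expr0 invr1 subrr.
    rewrite big_ord_recr /= subSnn.
    under eq_bigr => j _ do rewrite subSn ?(ltnW (ltn_ord j)) // exprS invfM.
    rewrite -mulr_sumr IH expr1 exprS invfM; lra.
  by rewrite lerBlDr lerDl invr_ge0 exprn_ge0.
rewrite lerN2 le_eqVlt; apply/orP; left; apply/eqP; elim: J {hL} => [|J IH].
  by rewrite big_ord0 /prime_range /index_iota subnn big_nil.
by rewrite (prime_range_cat _ (y J)) // big_cat big_ord_recr /= IH.
Qed.

(** * Mertens-type estimates for [g] *)

Lemma sum_prime_rangeE {R : realType} (f : nat -> R) b :
  \sum_(p <- prime_range 0 b) f p = \sum_(1 <= p < b.+1 | prime p) f p.
Proof. by rewrite big_filter. Qed.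

Lemma truncn_exp_mono {R : realType} (X : R) i k : 1 <= X -> (i <= k)%N ->
  (Num.truncn (X ^+ i) <= Num.truncn (X ^+ k))%N.
Proof. by move=> X1 ik; apply: le_truncn; rewrite ler_weXn2l. Qed.

Section Mertens.
Context {R : realType}.
Variables (g : nat -> R) (C X : R).
Hypothesis g01 : forall p, prime p -> 0 <= g p <= 1.
Hypothesis X1 : 1 < X.
Hypothesis mertens : forall t, X <= t ->
  `|\sum_(1 <= p < (Num.truncn t).+1 | prime p) g p * ln p%:R - ln t| <= C.

Let Q i k := prime_range (Num.truncn (X ^+ i)) (Num.truncn (X ^+ k)).

Lemma mertens_C_ge0 : 0 <= C.
Proof. exact: le_trans (normr_ge0 _) (mertens _ (lexx X)). Qed.

(** The hypothesis at [X ^+ i] is subtracted from that at [X ^+ k]; [0 < i] puts both points in its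
    range [X <= t]. *)
Lemma mertens_range i k : (0 < i)%N -> (i <= k)%N ->
  `|\sum_(p <- Q i k) g p * ln p%:R - (k - i)%N%:R * ln X| <= 2 * C.
Proof.
move=> i0 ik.
have XX j : (0 < j)%N -> X <= X ^+ j.
  by move=> j0; rewrite -{1}(expr1 X) ler_weXn2l // ltW.
have := mertens _ (XX i i0); have := mertens _ (XX k (leq_trans i0 ik)).
rewrite -!sum_prime_rangeE (prime_range_cat 0 (Num.truncn (X ^+ i))) //; last first.
  exact: truncn_exp_mono (ltW X1) ik.
rewrite big_cat /= !lnXn ?(lt_trans ltr01) // -!(mulr_natl (ln X)) natrB //.
rewrite -/(Q i k); set A := \sum_(p <- Q i k) _; set B := \sum_(_ <- _) _.
rewrite !ler_norml => /andP[h1 h2] /andP[h3 h4]; apply/andP; split; lra.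
Qed.

Lemma mem_truncn_range i k p : p \in Q i k ->
  [/\ prime p, X ^+ i <= p%:R & p%:R <= X ^+ k].
Proof.
rewrite mem_prime_range => /and3P[pp ip pk]; split => //.
  by apply/ltW/(lt_le_trans (truncnS_gt _)); rewrite ler_nat.
by rewrite -truncn_ge_nat // exprn_ge0 // ltW // (lt_trans ltr01).
Qed.

(** Here [ln p >= i * ln X], so [i * ln X] times the sum is at most [i * ln X + 2 * C], and
    [2 * C <= ln X / 4] accounts for the extra quarter. *)
Lemma mertens_dyadic_le i : (0 < i)%N -> 8 * C <= ln X ->
  \sum_(p <- Q i i.*2) g p <= 5 / 4.
Proof.
move=> i0 CX; have lX : 0 < ln X by rewrite ln_gt0.
have li : 0 < i%:R * ln X by rewrite mulr_gt0 ?ltr0n.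
rewrite -(ler_pM2l li) mulr_sumr.
have := mertens_range i i.*2 i0; rewrite -addnn leq_addr addnK => /(_ isT).
rewrite ler_norml => /andP[_ up].
apply: (@le_trans _ _ (\sum_(p <- Q i (i + i)) g p * ln p%:R)).
  rewrite !big_seq; apply: ler_sum => p /mem_truncn_range[pp ip _].
  have /andP[gp _] := g01 _ pp; rewrite mulrC ler_wpM2l //.
  rewrite mulr_natl -lnXn ?(lt_trans ltr01) // ler_ln ?posrE ?ltr0n ?prime_gt0 //.
  by rewrite exprn_gt0 // (lt_trans ltr01).
have : ln X <= i%:R * ln X by apply: ler_peMl; [exact: ltW | rewrite ler1n].
have := mertens_C_ge0; lra.
Qed.

Lemma ln_ratio_le (i : nat) :
  ln (i.+2%:R) - ln (i.+1%:R) <= i.+1%:R^-1 :> R.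
Proof.
rewrite -ln_div ?posrE ?ltr0n //.
have -> : i.+2%:R / i.+1%:R = 1 + i.+1%:R^-1 :> R.
  by rewrite -[i.+2]addn1 natrD mulrDl divff ?pnatr_eq0 // mul1r.
by apply: le_ln1Dx; rewrite (lt_le_trans (ltrN10 _)).
Qed.

(** Here [ln p <= i.+1 * ln X], so the sum is at least [(ln X - 2 * C) / (i.+1 * ln X)]. Its main
    part [1 / i.+1] is lowered to a difference of logarithms so that the steps telescope. *)
Lemma mertens_step_ge i : (0 < i)%N ->
  ln (i.+2%:R) - ln (i.+1%:R) - 2 * C / ln X <= \sum_(p <- Q i i.+1) g p.
Proof.
move=> i0; have lX : 0 < ln X by rewrite ln_gt0.
have C0 := mertens_C_ge0.
apply: (@le_trans _ _ (i.+1%:R^-1 - 2 * C / ln X / i.+1%:R)).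
  apply: lerB; first exact: ln_ratio_le.
  by rewrite ler_pdivrMr ?ltr0n // ler_peMr ?ler1n // divr_ge0 ?mulr_ge0 // ltW.
have li : 0 < i.+1%:R * ln X by rewrite mulr_gt0 ?ltr0n.
rewrite -(ler_pM2l li) mulr_sumr.
have := mertens_range i i.+1 i0; rewrite leqnSn subSnn mul1r => /(_ isT).
rewrite ler_norml => /andP[low _].
apply: (@le_trans _ _ (\sum_(p <- Q i i.+1) g p * ln p%:R)).
  apply: (@le_trans _ _ (ln X - 2 * C)); last by lra.
  rewrite le_eqVlt; apply/orP; left; apply/eqP; field.
  by rewrite nat1r pnatr_eq0 /= gt_eqF.
rewrite !big_seq; apply: ler_sum => p /mem_truncn_range[pp _ pk].
have /andP[gp _] := g01 _ pp; rewrite [leRHS]mulrC ler_wpM2l //.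
rewrite mulr_natl -lnXn ?(lt_trans ltr01) // ler_ln ?posrE ?ltr0n ?prime_gt0 //.
by rewrite exprn_gt0 // (lt_trans ltr01).
Qed.

(** Telescoping short steps replaces partial summation. The error is linear in [M], which is
    harmless when [M] is fixed and [X] grows. *)
Lemma mertens_sum_ge M : (0 < M)%N ->
  ln (M.+1%:R) - ln 2 - M%:R * (2 * C / ln X) <= \sum_(p <- Q 1 M) g p.
Proof.
elim: M => // -[|M] IH _.
  rewrite subrr sub0r mul1r /Q /prime_range /index_iota subnn big_nil oppr_le0.
  by apply: divr_ge0; [rewrite mulr_ge0 // mertens_C_ge0 | rewrite ltW // ln_gt0].
rewrite /Q (prime_range_cat _ (Num.truncn (X ^+ M.+1))) ?truncn_exp_mono ?(ltW X1) //.
rewrite big_cat /=; have := mertens_step_ge M.+1 isT; have := IH isT.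
rewrite /Q -(natr1 M.+1) mulrDl mul1r; lra.
Qed.

End Mertens.

(** * Integers with a very large prime factor *)

Lemma no_prime_in_gap {R : realType} (x eps kappa : R) (y z n p : nat) :
  1 < x -> 0 < eps -> eps <= kappa -> kappa <= 8^-1 ->
  n%:R <= x -> x `^ 2^-1 < n%:R ->
  n%:R `^ (1 - eps) <= (max_pdiv n)%:R ->
  (x `^ eps < y.+1%:R) -> (z%:R <= x `^ kappa) ->
  p \in prime_range y z -> ~~ (p %| n)%N.
Proof.
move=> x1 e0 ek k8 nx xn nP xy zx; rewrite mem_prime_range => /and3P[pp yp pz].
have x0 : 0 < x by apply: lt_trans x1.
have n1 : (1 < n)%N.
  rewrite -(ltr_nat R); apply: le_lt_trans xn.
  by rewrite -[leLHS](powRr0 x) ler_powR // ?(ltW x1) // invr_ge0.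
have n0 : 0 < n%:R :> R by rewrite ltr0n (ltn_trans _ n1).
apply/negP => pn; set q := max_pdiv n in nP.
have qp : prime q by rewrite max_pdiv_prime.
have qn : (q %| n)%N by rewrite max_pdiv_dvd.
(* If [p] is the largest prime factor itself, then [n^(1 - eps) <= x^kappa], which contradicts
   [n > x^(1/2)] because [kappa <= 1/8 < (1 - eps) / 2]. *)
have [pq|pq] := eqVneq p q.
  have : n%:R `^ (1 - eps) <= x `^ kappa.
    by apply: (le_trans nP); apply: le_trans zx; rewrite ler_nat -pq.
  apply/negP; rewrite -ltNge.
  apply: (@le_lt_trans _ _ (x `^ (2^-1 * (1 - eps)))).
    by rewrite ler_powR ?(ltW x1) //; lra.
  rewrite powRrM; apply: gt0_ltr_powR; rewrite ?nnegrE ?powR_ge0 ?ler0n //; lra.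
(* Otherwise [p * q <= n = n^eps * n^(1 - eps)], although [p > x^eps >= n^eps] and
   [q >= n^(1 - eps)]. *)
have pqn : (p * q <= n)%N.
  apply: dvdn_leq; first by rewrite (ltn_trans _ n1).
  by rewrite Gauss_dvd ?pn // prime_coprime // dvdn_prime2.
have : (p * q)%:R <= n%:R `^ eps * n%:R `^ (1 - eps) :> R.
  rewrite -powRD; last by rewrite (gt_eqF n0) implybT.
  by rewrite subrKC powRr1 ?ler0n // ler_nat.
apply/negP; rewrite -ltNge natrM.
apply: (@lt_le_trans _ _ (p%:R * n%:R `^ (1 - eps))); last exact: ler_wpM2l.
rewrite ltr_pM2r ?powR_gt0 //; apply: (@le_lt_trans _ _ (x `^ eps)).
  by rewrite ge0_ler_powR ?nnegrE ?ler0n // ltW.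
by apply: (lt_le_trans xy); rewrite ler_nat.
Qed.

(** * Probabilities and upper limits *)

Lemma probability_le_sum {R : realType} d (T : measurableType d)
    (P : probability T R) (u : {RV P >-> nat}) (f : nat -> R) (E : pred nat)
    (N : nat) :
  (forall m, P [set w | u w = m] = (f m)%:E) ->
  (forall m, ~~ ((0 < m)%N && (m <= N)%N) -> f m = 0) ->
  (P [set w | E (u w)] <= (\sum_(1 <= m < N.+1 | E m) f m)%:E)%E.
Proof.
move=> Pf f0.
have f_ge0 m : 0 <= f m by rewrite -lee_fin -Pf measure_ge0.
pose F m := [set w | u w = m /\ E m].
have mF m : measurable (F m).
  rewrite /F; case Em : (E m); last first.
    by rewrite (_ : [set _ | _] = set0) // -subset0 => w /= [].
  rewrite (_ : [set _ | _] = u @^-1` [set m]); last by apply/seteqP; split=> w //= -[].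
  by rewrite -[X in measurable X]setTI; apply: measurable_funP.
(* Splitting by the value of [u] makes countable additivity applicable; the terms of the series
   vanish outside [1 <= m <= N]. *)
have -> : [set w | E (u w)] = \bigcup_m F m.
  apply/seteqP; split=> w /=; first by move=> Ew; exists (u w).
  by case=> m _ [-> ].
rewrite measure_bigcup //; last first.
  by move=> i j _ _ [w /= [[<- _] [<- _]]].
have PF m : P (F m) = (if E m then f m else 0)%:E.
  rewrite /F; case Em : (E m); last first.
    by rewrite (_ : [set _ | _] = set0) ?measure0 // -subset0 => w /= [].
  by rewrite -Pf; congr (P _); apply/seteqP; split=> w //= -[].
rewrite eseries_mkcond.
apply: lime_le; first by apply: is_cvg_nneseries => m _ _; case: ifP.
near=> n.
rewrite (eq_bigr (fun m => (if E m then f m else 0)%:E)); last first.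
  by move=> m _; rewrite in_setT; exact: PF.
rewrite sumEFin lee_fin [leRHS]big_mkcond /=.
apply: (@le_trans _ _ (\sum_(m <- [seq m <- index_iota 0 n | (0 < m <= N)%N])
    (if E m then f m else 0))).
  rewrite big_filter [leRHS]big_mkcond /=; apply: ler_sum => m _.
  by case: (boolP (0 < m <= N)%N) => [//|/f0 ->]; rewrite if_same.
apply: uniq_sub_ler_sum.
- by rewrite filter_uniq // iota_uniq.
- exact: iota_uniq.
- by move=> m; rewrite mem_filter !mem_index_iota !ltnS => /andP[].
- by move=> m _; case: ifP.
Unshelve. all: by end_near.
Qed.

Lemma limf_esup_le_near {R : realType} (f : R -> \bar R) (c : \bar R) :
  (\forall x \near +oo, (f x <= c)%E) -> (limf_esup f (pinfty_nbhs R) <= c)%E.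
Proof.
move=> fc; rewrite limf_esupE; apply: ereal_inf_le.
exists (ereal_sup (f @` [set x | (f x <= c)%E])); first by exists [set x | (f x <= c)%E].
by apply: ge_ereal_sup => _ [x /= ? <-].
Qed.

Lemma near_ln_ge {R : realType} (A : R) : \forall x \near +oo, A <= ln x.
Proof.
exists (expR A); split; first exact: num_real.
move=> x Ax; rewrite -[A]expRK ler_ln ?posrE ?expR_gt0 ?ltW //.
exact: lt_trans (expR_gt0 _) Ax.
Qed.

(** * The sieve at dyadic scales *)

Lemma sum_level_exponents_le J : (\sum_(j < J) (J - j) * 2 ^ j <= 2 ^ J.+1)%N.
Proof.
(* The exact value lets the induction close. *)
suff : (\sum_(j < J) (J - j) * 2 ^ j + J + 2 = 2 ^ J.+1)%N by lia.
elim: J => [|J IH]; first by rewrite big_ord0.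
have -> : (\sum_(j < J.+1) (J.+1 - j) * 2 ^ j = J.+1 + 2 * \sum_(j < J) (J - j) * 2 ^ j)%N.
  rewrite big_ord_recl /= subn0 muln1 big_distrr /=; congr (_ + _)%N.
  by apply: eq_bigr => i _; rewrite /bump /= add1n subSS expnS mulnCA.
rewrite (expnS 2 J.+1); lia.
Qed.

Lemma sifted_mass_le {R : realType} (a : nat -> R) (theta kappa eta : R)
    (J : nat) :
  (forall n, (0 < n)%N -> 0 <= a n) -> level_of_distribution a theta ->
  0 < kappa -> 8 * kappa < theta -> 0 < eta ->
  \forall x \near +oo,
    \sum_(1 <= n < (Num.truncn x).+1 |
        all (fun p => ~~ (p %| n)%N)
          (prime_range (Num.truncn (x `^ (kappa / 2 ^+ J)))
                       (Num.truncn (x `^ kappa)))) a n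
      <= (2 * expR 11 / 2 ^+ J + eta) * summatory a x.
Proof.
move=> a0 [g [gM g01 /eqO_exP[C C0 [t0 [_ mertens]]] _ level]] k0 kt eta0.
have k80 : 0 < 8 * kappa by rewrite mulr_gt0.
(* Saving one logarithm suffices: the remainder [k * summatory a x / ln x] eventually drops below
   [eta * summatory a x]. *)
have /eqO_exP[k kk0 levelk] := level (8 * kappa) 1 k80 kt ltr01.
have J0 : 0 < 2 ^+ J :> R by rewrite exprn_gt0.
set s := kappa / 2 ^+ J; have s0 : 0 < s by rewrite divr_gt0.
near=> x.
have lx1 : 1 <= ln x by near: x; exact: near_ln_ge.
have x1 : 1 < x by rewrite ltNge; apply/negP => /ln_le0; rewrite leNgt (lt_le_trans ltr01).
have x0 : 0 < x by apply: lt_trans x1.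
set X := x `^ s.
have lnX : ln X = s * ln x by rewrite ln_powR.
have lnX_ge A : A / s <= ln x -> A <= ln X.
  by rewrite lnX ler_pdivrMr // mulrC.
have X0 : 0 < X by rewrite powR_gt0.
have XlnX : 1 + ln X <= X by rewrite -[leRHS]lnK ?posrE // expR_ge1Dx.
have lX1 : 1 <= ln X by apply: lnX_ge; near: x; exact: near_ln_ge.
(* These thresholds make the Mertens bound valid from [X] on, keep each block sum at most [5 / 4],
   and keep the accumulated Mertens error over [2 ^ J] steps at most 1. *)
have lXt : t0 <= ln X by apply: lnX_ge; near: x; exact: near_ln_ge.
have lXC : 8 * C <= ln X by apply: lnX_ge; near: x; exact: near_ln_ge.
have lXJ : 2 ^+ J * (2 * C) <= ln X by apply: lnX_ge; near: x; exact: near_ln_ge.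
have X1 : 1 < X by lra.
have gp p : prime p -> 0 <= g p <= 1 by move=> pp; rewrite g01 // prime_gt0.
have mert t : X <= t ->
    `|\sum_(1 <= p < (Num.truncn t).+1 | prime p) g p * ln p%:R - ln t| <= C.
  by move=> Xt; have := mertens t; rewrite normr1 mulr1; apply; lra.
pose y j := Num.truncn (X ^+ (2 ^ j)).
pose m j := (J - j).*2.+1.
have y_mono j : (y j <= y j.+1)%N by rewrite truncn_exp_mono ?(ltW X1) // leq_exp2l.
have y_gt0 j : (0 < y j)%N by rewrite truncn_gt0 exprn_ege1 // ltW.
have XJ : X ^+ (2 ^ J) = x `^ kappa.
  rewrite -powR_mulrn ?ltW // -powRrM natrX; congr (_ `^ _).
  by rewrite /s divfK // gt_eqF.
have m_odd j : odd (m j) by rewrite /m /= odd_double.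
have leD : (\prod_(j < J) y j.+1 ^ (m j).-1 <= Num.truncn (x `^ (8 * kappa)))%N.
  rewrite truncn_ge_nat ?powR_ge0 //.
  (* Block [j] contributes at most [2 * (J - j)] primes of size at most [X^(2^(j+1))]. By
     [sum_level_exponents_le] the exponents total at most [8 * 2^J], and [X^(2^J) = x^kappa]. *)
  apply: (@le_trans _ _ (X ^+ (8 * 2 ^ J))); last first.
    by rewrite mulnC exprM XJ mulrC powRrM powR_mulrn // powR_ge0.
  rewrite natr_prod; apply: (@le_trans _ _ (X ^+ (\sum_(j < J) 4 * ((J - j) * 2 ^ j)))).
    rewrite expr_sum; apply: ler_prod => j _; rewrite natrX exprn_ge0 //=.
    have -> : (4 * ((J - j) * 2 ^ j) = 2 ^ j.+1 * (m j).-1)%N.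
      by rewrite /m /= expnS -mul2n mulnACA [(2 ^ j * _)%N]mulnC.
    rewrite exprM lerXn2r ?nnegrE ?ler0n ?exprn_ge0 ?(ltW X0) //.
    by rewrite truncn_le exprn_ge0 // ltW.
  rewrite ler_weXn2l ?(ltW X1) // -big_distrr /=.
  by rewrite -[8%N]/(4 * 2)%N -mulnA -expnS leq_pmul2l // sum_level_exponents_le.
have := sieve_upper_bound a g x m y J _ a0 gM y_mono y_gt0 m_odd leD.
rewrite {1 2}/y XJ expn0 expr1 => /le_trans; apply.
have N0 : 0 <= summatory a x.
  by rewrite /summatory big_nat sumr_ge0 // => n /andP[n0 _]; exact: a0.
rewrite [leRHS]mulrDl lerD //.
  rewrite mulrC ler_wpM2r //.
  apply: le_trans (block_product_le _ _ _ y_mono gp _) _.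
    move=> j jJ; rewrite /range_block /y expnS mul2n.
    by apply: (mertens_dyadic_le g C); rewrite ?expn_gt0.
  have := mertens_sum_ge g C X gp X1 mert (2 ^ J); rewrite expn_gt0 => /(_ isT).
  rewrite /y expn0; set L := \sum_(p <- _) _ => HL.
  have dJ : (2 ^ J)%:R * (2 * C / ln X) <= 1.
    by rewrite natrX mulrA ler_pdivrMr ?mul1r //; lra.
  (* The 11 is the 10 of [block_product_le] plus the Mertens error [dJ]; [ln 2] is the starting
     value of the telescoping sum. *)
  apply: (@le_trans _ _ (expR (11 + ln 2 - ln (2 ^+ J)))).
    have : ln (2 ^+ J) <= ln ((2 ^ J).+1%:R) :> R.
      by rewrite ler_ln ?posrE ?ltr0n // -natrX ler_nat.
    by rewrite ler_expR; lra.
  rewrite expRD expRD expRN !lnK ?posrE //; lra.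
have lev : \sum_(1 <= d < (Num.truncn (x `^ (8 * kappa))).+1)
    `|summatory_dvd a d x - g d * summatory a x| <= k * (summatory a x / ln x).
  have : `|(\sum_(1 <= d < (Num.truncn (x `^ (8 * kappa))).+1)
      `|summatory_dvd a d x - g d * summatory a x|)| <=
      k * `|summatory a x / ln x `^ 1| by near: x; exact: levelk.
  rewrite powRr1; last by lra.
  rewrite !ger0_norm ?sumr_ge0 // divr_ge0 //; lra.
apply: (le_trans lev); rewrite mulrCA mulrC ler_wpM2r //.
rewrite ler_pdivrMr; last by lra.
have : k / eta <= ln x by near: x; exact: near_ln_ge.
by rewrite ler_pdivrMr // mulrC.
Unshelve. all: by end_near.
Qed.

(** [J] is the largest integer with [2^J <= kappa / eps]; maximality gives the second bound. *)
Lemma dyadic_scale {R : realType} (eps kappa : R) : 0 < eps -> eps <= kappa ->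
  exists J, eps <= kappa / 2 ^+ J /\ (2 ^+ J)^-1 <= 2 * eps / kappa.
Proof.
move=> e0 ek; have k0 : 0 < kappa by apply: lt_le_trans ek.
have q1 : 1 <= kappa / eps by rewrite ler_pdivlMr // mul1r.
have n0 : (0 < Num.truncn (kappa / eps))%N by rewrite truncn_gt0.
have /andP[lo up] := trunc_log_bounds (isT : 1 < 2)%N n0.
exists (trunc_log 2 (Num.truncn (kappa / eps))).
set J := trunc_log _ _ in lo up *.
have J0 : 0 < 2 ^+ J :> R by rewrite exprn_gt0.
rewrite truncn_ge_nat ?(le_trans ler01) // natrX in lo.
move: up; rewrite truncn_lt_nat ?(le_trans ler01) // natrX => up; split.
  by rewrite ler_pdivlMr // mulrC -ler_pdivlMr.
rewrite -[X in X <= _]mul1r ler_pdivrMr // mulrAC ler_pdivlMr // mul1r.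
move: up; rewrite ltr_pdivrMr // exprS; lra.
Qed.

(** The integers up to [x^(1/2)] are put into the first term, to be handled by regularity; by
    [no_prime_in_gap] the larger ones survive the sifting. *)
Lemma large_prime_mass_le {R : realType} (a : nat -> R) (x eps kappa : R) (y z : nat) :
  (forall n, (0 < n)%N -> 0 <= a n) ->
  1 < x -> 0 < eps -> eps <= kappa -> kappa <= 8^-1 ->
  x `^ eps < y.+1%:R -> z%:R <= x `^ kappa ->
  \sum_(1 <= n < (Num.truncn x).+1 |
      n%:R `^ (1 - eps) <= (max_pdiv n)%:R) a n <=
  summatory a (x `^ 2^-1) +
  \sum_(1 <= n < (Num.truncn x).+1 |
      all (fun p => ~~ (p %| n)%N) (prime_range y z)) a n.
Proof.
move=> a0 x1 e0 ek k8 xy zx; have x0 : 0 <= x by rewrite ltW // (lt_trans ltr01).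
apply: (@le_trans _ _ (\sum_(1 <= n < (Num.truncn x).+1 | n%:R <= x `^ 2^-1) a n +
  \sum_(1 <= n < (Num.truncn x).+1 |
      all (fun p => ~~ (p %| n)%N) (prime_range y z)) a n)).
  rewrite big_mkcond [X in _ <= X + _]big_mkcond [X in _ <= _ + X]big_mkcond /=.
  rewrite -big_split /= big_nat [leRHS]big_nat; apply: ler_sum => n /andP[n0].
  rewrite ltnS truncn_ge_nat // => nx; have an := a0 n n0.
  case: ifP => [nP|_]; last by apply: addr_ge0; case: ifP.
  case: (lerP _ (x `^ 2^-1)) => xn.
    by rewrite lerDl; case: ifP.
  rewrite add0r ifT //; apply/allP => p.
  exact: no_prime_in_gap x1 e0 ek k8 nx xn nP xy zx.
rewrite lerD2r -big_filter; apply: uniq_sub_ler_sum.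
- by rewrite filter_uniq // iota_uniq.
- exact: iota_uniq.
- move=> n; rewrite mem_filter !mem_index_iota !ltnS => /and3P[nx -> _] /=.
  by rewrite truncn_ge_nat ?powR_ge0.
- by move=> n; rewrite mem_index_iota => /andP[/a0].
Qed.

(** * From mass bounds to the upper limit of the probabilities *)

Theorem theorem1p8 (R : realType) (a : nat -> R)
    (a_ge0 : forall n : nat, (0 < n)%N -> 0 <= a n)
    (a_regular : regular a)
    (a_level : positive_level_of_distribution a)
    (a_uniform : locally_uniform a) :
  exists2 K : R, 0 < K &
    forall (disp : R -> measure_display)
           (T : forall x : R, measurableType (disp x))
           (P : forall x : R, probability (T x) R)
           (u : forall x : R, {RV (P x) >-> nat}),
      (\forall x \near +oo, forall m : nat,
          P x [set w | u x w = m] =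
          (a m / summatory a x * ((0 < m)%N && (m%:R <= x))%:R)%:E) ->
      forall eps : R, 0 < eps ->
        (limf_esup
           (fun x : R =>
              P x [set w | (u x w)%:R `^ (1 - eps) <= (max_pdiv (u x w))%:R]%R)
           (pinfty_nbhs R)
         <= (K * eps)%:E)%E.
Proof.
have [theta theta0 level] := a_level.
(* The 9 keeps the level [8 * kappa] strictly below [theta]; [1 / 8] is what [no_prime_in_gap] asks
   for. *)
pose kappa : R := Num.min (theta / 9) 8^-1.
have k0 : 0 < kappa by rewrite lt_min; apply/andP; split; lra.
have k8 : kappa <= 8^-1 by rewrite ge_min lexx orbT.
have kt : 8 * kappa < theta.
  have : kappa <= theta / 9 by rewrite ge_min lexx.
  by lra.
have e11 : 0 < expR 11 :> R by exact: expR_gt0.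
(* [1 / kappa] covers [eps > kappa], where the bound exceeds 1; [4 * expR 11 / kappa] is the sieve
   main term after [dyadic_scale]; the 2 collects the errors from regularity and from the
   remainder. *)
exists ((1 + 4 * expR 11) / kappa + 2).
  by rewrite addr_gt0 // divr_gt0 // addr_gt0 // mulr_gt0.
move=> disp T P u Pu eps e0; apply: limf_esup_le_near.
have [ek|ke] := lerP eps kappa; last first.
  apply: nearW => x; apply: (@le_trans _ _ 1%:E).
    apply: probability_le1.
    rewrite -[X in measurable X]setTI.
    exact: (measurable_funP (u x) measurableT
      [set n : nat | n%:R `^ (1 - eps) <= (max_pdiv n)%:R]).
  rewrite lee_fin; apply: (@le_trans _ _ (kappa^-1 * eps)).
    by rewrite mulrC ler_pdivlMr // mul1r ltW.
  rewrite ler_wpM2r ?(ltW e0) // mulrDl mul1r -addrA lerDl.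
  by rewrite addr_ge0 // divr_ge0 ?(ltW k0) // mulr_ge0 // ltW.
have [J [eJ Je]] := dyadic_scale _ _ e0 ek.
(* Regularity at exponent [1 / 2] and the sieve are both used with tolerance [eps]: the threshold
   for [x] may depend on [eps], while the constant does not. *)
have /eqoP/(_ eps e0) reg := a_regular 2^-1 ltac:(lra).
have sift := sifted_mass_le _ _ _ _ J a_ge0 level k0 kt e0.
near=> x.
have lx1 : 1 <= ln x by near: x; exact: near_ln_ge.
have x1 : 1 < x.
  by rewrite ltNge; apply/negP => /ln_le0; rewrite leNgt (lt_le_trans ltr01).
have x0 : 0 <= x by rewrite ltW // (lt_trans ltr01).
have Pux : forall m, P x [set w | u x w = m] =
    (a m / summatory a x * ((0 < m)%N && (m%:R <= x))%:R)%:E.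
  by near: x; exact: Pu.
apply: le_trans (probability_le_sum _ _ _ _ _
  (fun n => n%:R `^ (1 - eps) <= (max_pdiv n)%:R) (Num.truncn x) Pux _) _.
  by move=> m; rewrite truncn_ge_nat // => /negbTE ->; rewrite mulr0.
rewrite lee_fin; set S := summatory a x.
have S0 : 0 <= S.
  by rewrite /S /summatory big_nat sumr_ge0 // => n /andP[n0 _]; exact: a_ge0.
set K := _ / kappa + 2.
have Keps : 0 <= K * eps.
  by apply: mulr_ge0; [apply: addr_ge0 => //; apply: divr_ge0; lra | exact: ltW].
apply: (@le_trans _ _ ((\sum_(1 <= n < (Num.truncn x).+1 |
    n%:R `^ (1 - eps) <= (max_pdiv n)%:R) a n) / S)).
  rewrite mulr_suml big_nat_cond [leRHS]big_nat_cond.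
  apply: ler_sum => n /andP[/andP[n0 _] _].
  by rewrite ler_piMr ?divr_ge0 ?a_ge0 // lern1 leq_b1.
(* For zero total mass the quotient is 0, since the inverse of 0 is 0. *)
have [->|Sn0] := eqVneq S 0; first by rewrite invr0 mulr0.
rewrite ler_pdivrMr; last by rewrite lt_neqAle eq_sym Sn0.
apply: le_trans (large_prime_mass_le _ _ _ _
  (Num.truncn (x `^ (kappa / 2 ^+ J))) (Num.truncn (x `^ kappa))
  a_ge0 x1 e0 ek k8 _ _) _.
- by apply: le_lt_trans (truncnS_gt _); rewrite ler_powR // ltW.
- by rewrite truncn_le powR_ge0.
have regx : summatory a (x `^ 2^-1) <= eps * S.
  have : `|summatory a (x `^ 2^-1)| <= eps * `|summatory a x|.
    by near: x; exact: reg.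
  by rewrite (ger0_norm S0); apply: le_trans; exact: ler_norm.
have siftx : \sum_(1 <= n < (Num.truncn x).+1 |
      all (fun p => ~~ (p %| n)%N)
        (prime_range (Num.truncn (x `^ (kappa / 2 ^+ J))) (Num.truncn (x `^ kappa))))
      a n <= (2 * expR 11 / 2 ^+ J + eps) * summatory a x.
  by near: x; exact: sift.
apply: (le_trans (lerD regx siftx)); rewrite -mulrDl ler_wpM2r //.
have : 2 * expR 11 / 2 ^+ J <= 2 * expR 11 * (2 * eps / kappa).
  by apply: ler_wpM2l => //; lra.
have : 0 <= eps / kappa by apply: divr_ge0; apply: ltW.
have -> : K * eps = eps / kappa + 4 * expR 11 * (eps / kappa) + 2 * eps.
  by rewrite /K; ring.
have -> : 2 * expR 11 * (2 * eps / kappa) = 4 * expR 11 * (eps / kappa) by ring.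
by lra.
Unshelve. all: by end_near.
Qed.
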